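(* For every integer $d \ge 1$ there exists a full-rank lattice $\Lambda$ in $\mathbb{R}^d$ such that $\Lambda \cap H^d = \{0\}$, where \[ H^d = \{x = (x_1, \dotsc, x_d) \in \mathbb{R}^d : |x_1 x_2 \dotsm x_d| < 1\}. \]
   Context: A full-rank lattice in $\mathbb{R}^d$ is a subgroup of the form $v_1\mathbb{Z} + \dotsb + v_d\mathbb{Z}$ with $v_1, \dotsc, v_d$ a basis of $\mathbb{R}^d$ over $\mathbb{R}$. *)

(* Defs.v *)
From HB Require Import structures.
From mathcomp Require Import all_boot all_order all_algebra.
From mathcomp Require Import classical_sets reals.

Set Implicit Arguments.
Unset Strict Implicit.
Unset Printing Implicit Defensive.

Import Order.TTheory GRing.Theory Num.Theory.
Local Open Scope classical_set_scope.
Local Open Scope ring_scope.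

Definition int_span (R : realType) (d : nat) (v : d.-tuple 'rV[R]_d) :
    set 'rV[R]_d :=
  [set x : 'rV[R]_d | exists a : 'I_d -> int, 
    x = \sum_(i < d) tnth v i *~ a i].

Definition full_rank_lattice (R : realType) (d : nat) (L : set 'rV[R]_d) : Prop :=
  exists2 v : d.-tuple 'rV[R]_d, basis_of fullv v & L = int_span v.

Definition hyperbolic_region (R : realType) (d : nat) : set 'rV[R]_d :=
  [set x : 'rV[R]_d | `|\prod_(i < d) x ord0 i| < 1].

Arguments hyperbolic_region R d : clear implicits.

(* Main.v *)
Require Import Defs.
From HB Require Import structures.
From mathcomp Require Import all_boot all_order all_algebra.
From mathcomp Require Import classical_sets reals.
From mathcomp Require Import polyrcf lra zify.

Import Order.TTheory GRing.Theory Num.Theory.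
Local Open Scope classical_set_scope.
Local Open Scope ring_scope.

(** Write sigma_1, ..., sigma_d for the real embeddings of a totally real number
field K = Q(t) of degree d, with t an algebraic integer.  The image of the order Z[t] under
(sigma_1, ..., sigma_d) is a full-rank lattice, and the product of the
coordinates of the image of an element is its norm.  The norm of a nonzero
algebraic integer is a nonzero rational integer, so its absolute value is at
least 1 and no nonzero lattice point lies in the hyperbolic region.

It remains to exhibit such a field in every degree.  The polynomial
f = \prod_(i < d) ('X - a_i) - 1 is irreducible over Q as soon as the a_i are
distinct integers ([irreducible_prodXsub_sub1]), and it has d distinct real
roots t_j when a_i = 4 i, because subtracting 1 does not affect the alternating
signs of the product halfway between consecutive multiples of 4
([exists_prodXsub_sub1_roots]).

The number field itself never appears.  The lattice is spanned by the rows
(t_0 ^+ i, ..., t_(d-1) ^+ i) of a Vandermonde matrix, so that its points are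
the vectors of values p(t_j) with p an integer polynomial of degree less than
d.  The product of these values is an integer because it is the determinant of
multiplication by p on Z[X]/(f) ([prod_horner_roots_int]), and it is nonzero
because the irreducible f cannot share a root with a nonzero polynomial of
smaller degree ([irreducible_horner_neq0]). *)

Definition prodXsub_sub1 {d : nat} (a : 'I_d -> int) : {poly int} :=
  \prod_(i < d) ('X - (a i)%:P) - 1.

Lemma size_prod_XsubC_ord (R : comNzRingType) (d : nat) (a : 'I_d -> R) :
  size (\prod_(i < d) ('X - (a i)%:P)) = d.+1.
Proof. by rewrite -big_enum size_prod_XsubC size_enum_ord. Qed.

Lemma size_prodXsub_sub1 {d : nat} (a : 'I_d -> int) :
  (1 <= d)%N -> size (prodXsub_sub1 a) = d.+1.
Proof.
move=> d_gt0; rewrite /prodXsub_sub1 size_polyDl size_prod_XsubC_ord //.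
by rewrite size_polyN size_poly1 ltnS.
Qed.

Lemma monic_prodXsub_sub1 {d : nat} (a : 'I_d -> int) :
  (1 <= d)%N -> prodXsub_sub1 a \is monic.
Proof.
move=> d_gt0; rewrite monicE lead_coefDl -?monicE ?monic_prod_XsubC //.
by rewrite size_polyN size_poly1 size_prod_XsubC_ord ltnS.
Qed.

(** If f = g h over the integers, then g(a_i) h(a_i) = -1, which forces
g(a_i) = - h(a_i) for every i.  When both factors have degree less than d, the
polynomial g + h vanishes at d points and is therefore 0; but then f = - g ^+ 2
has a negative leading coefficient. *)
Lemma irreducible_prodXsub_sub1 {d : nat} (a : 'I_d -> int) :
  (1 <= d)%N -> injective a ->
  irreducible_poly (map_poly (intr : int -> rat) (prodXsub_sub1 a)).
Proof.
move=> d_gt0 a_inj; have size_f := size_prodXsub_sub1 a d_gt0.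
split; first by rewrite size_rat_int_poly size_f ltnS.
move=> q size_q dvd_q; rewrite -dvdp_size_eqp // size_rat_int_poly size_f.
(* Gauss's lemma turns a rational divisor into an integral one. *)
have [g [c c_neq0 q_eq] [h f_eq]] := dvdpP_rat_int dvd_q.
move: size_q; rewrite q_eq size_scale // size_rat_int_poly => size_g.
have f_neq0 : prodXsub_sub1 a != 0 by rewrite -size_poly_gt0 size_f.
have /andP[g_neq0 h_neq0] : (g != 0) && (h != 0).
  by rewrite -negb_or -mulf_eq0 -f_eq.
have size_gh : (size g + size h = d.+2)%N.
  have := size_f; rewrite f_eq size_mul // => <-.
  by rewrite prednK // addn_gt0 size_poly_gt0 g_neq0.
have g_gt1 : (1 < size g)%N by rewrite ltn_neqAle eq_sym size_g size_poly_gt0.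
have h_gt0 : (0 < size h)%N by rewrite size_poly_gt0.
apply/negPn/negP => size_g_neq.
have sum_size : (size (g + h)%R <= d)%N.
  apply: leq_trans (size_polyD _ _) _; rewrite geq_max.
  move: g_gt1 h_gt0 size_gh size_g_neq.
  by move: (size g) (size h) => m n; lia.
have sum_root i : root (g + h) (a i).
  have : g.[a i] * h.[a i] = -1.
    rewrite -hornerM -f_eq /prodXsub_sub1 !hornerE horner_prod (bigD1 i) //=.
    by rewrite hornerXsubC subrr mul0r sub0r.
  move=> gh; have h_unit : - g.[a i] * h.[a i] = 1 by rewrite mulNr gh opprK.
  rewrite rootE hornerD; have := intUnitRing.unitzPl h_unit.
  rewrite qualifE /= => /orP[] /eqP h_eq; move: gh; rewrite h_eq ?mulrN mulr1.
    by move=> ->; rewrite addNr.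
  by move=> /oppr_inj ->; rewrite subrr.
have sum_eq0 : g + h = 0.
  apply: contraTeq sum_size => gh_neq0; rewrite -ltnNge.
  rewrite -[X in (X < _)%N](size_enum_ord d) -(size_map a).
  apply: max_poly_roots => //; last by rewrite map_inj_uniq ?enum_uniq.
  by apply/allP => _ /mapP[i _ ->].
have := monic_prodXsub_sub1 a d_gt0; rewrite monicE f_eq lead_coefM.
move/eqP: sum_eq0; rewrite addrC addr_eq0 => /eqP ->; rewrite lead_coefN.
rewrite mulrN -expr2 => lead_sqr; have := sqr_ge0 (lead_coef g).
by rewrite -oppr_le0 (eqP lead_sqr).
Qed.

(** At the points m_k = 4 k - 2, halfway between consecutive multiples of 4, the
product has absolute value more than 1 and a sign that alternates with k.  So the signs
survive the subtraction of 1, and each of the d intervals ]m_k, m_(k+1)[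
contains a root. *)
Lemma exists_prodXsub_sub1_roots (R : rcfType) {d : nat} : (1 <= d)%N ->
  exists2 t : 'rV[R]_d, injective (t 0) &
    forall j, root (map_poly intr (prodXsub_sub1 (fun i : 'I_d => (4 * i)%N%:Z)))
                   (t 0 j).
Proof.
move=> d_gt0.
set f := map_poly _ _.
pose g (x : R) := \prod_(i < d) (x - (4 * i)%N%:R).
pose m (k : nat) : R := 4 * k%:R - 2.
have fE x : f.[x] = g x - 1.
  rewrite /f rmorphB rmorph1 rmorph_prod !hornerE horner_prod.
  congr (_ - _); apply: eq_bigr => i _.
  by rewrite rmorphB /= map_polyX map_polyC /= !hornerE.
have far k : 1 < `|g (m k)|.
  rewrite normr_prod.
  have ge2 (i : 'I_d) : 2 <= `|m k - (4 * i)%N%:R|.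
    rewrite ler_normr /m natrM; have [lt_ik|le_ki] := ltnP i k.
      have : (i.+1%:R : R) <= k%:R by rewrite ler_nat.
      by rewrite -natr1; lra.
    have : (k%:R : R) <= i%:R by rewrite ler_nat.
    by lra.
  apply: (@lt_le_trans _ _ (\prod_(i < d) 2)).
    by rewrite prodr_const card_ord exprn_egt1 ?ltr1n // -lt0n.
  by apply: ler_prod => i _; rewrite ge2 ler0n.
have alternate (k : 'I_d) : g (m k) * g (m k.+1) < 0.
  (* Only the zero 4 k lies between m_k and m_(k+1). *)
  rewrite /g -big_split (bigD1 k) //= nmulr_rlt0.
    apply: prodr_gt0 => i; rewrite neq_ltn /m !natrM -natr1 => /orP[] lt_ik.
      have : (i.+1%:R : R) <= k%:R by rewrite ler_nat.
      by rewrite -natr1 => ?; apply: mulr_gt0; lra.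
    have : (k.+1%:R : R) <= i%:R by rewrite ler_nat.
    by rewrite -natr1 => ?; rewrite nmulr_rgt0; lra.
  by rewrite /m natrM -natr1; lra.
have sep (k : 'I_d) : {x | x \in `]m k, m k.+1[ & root f x}.
  apply: poly_ivtoo; first by rewrite /m -natr1; lra.
  rewrite !fE; have := alternate k; have := far k; have := far k.+1.
  rewrite !ltr_normr => /orP[] ? /orP[] ?; nra.
pose x (k : 'I_d) : R := s2val (sep k).
have x_lt (j k : 'I_d) : (j < k)%N -> x j < x k.
  move=> lt_jk; have := s2valP (sep j); have := s2valP (sep k).
  rewrite !in_itv /= -!/(x _) => /andP[lo_k _] /andP[_ hi_j].
  have : (j.+1%:R : R) <= k%:R by rewrite ler_nat.
  by move: lo_k hi_j; rewrite /m; lra.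
exists (\row_k x k) => [j k|j]; rewrite !mxE; last exact: (s2valP' (sep j)).
case: (ltngtP j k) => [/x_lt lt_x|/x_lt lt_x|/val_inj //] eq_x.
  by move: lt_x; rewrite eq_x ltxx.
by move: lt_x; rewrite eq_x ltxx.
Qed.

Lemma Vandermonde_unit {F : fieldType} {d : nat} {t : 'rV[F]_d} :
  injective (t 0) -> Vandermonde d t \in unitmx.
Proof.
move=> t_inj; rewrite unitmxE unitfE det_Vandermonde.
apply/prodf_neq0 => i _; apply/prodf_neq0 => j lt_ij.
by rewrite subr_eq0; apply: contraTneq lt_ij => /t_inj ->; rewrite ltnn.
Qed.

Lemma basis_rows_unitmx {F : fieldType} {d : nat} {V : 'M[F]_d} :
  V \in unitmx -> basis_of fullv [tuple row i V | i < d].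
Proof.
move=> V_unit; rewrite basisEfree subvf size_tuple dimvf dim_matrix mul1r.
rewrite leqnn !andbT; apply/freeP => k.
under eq_bigr do rewrite -tnth_nth tnth_mktuple.
move=> k_eq0 i; have: \row_j k j *m V = 0.
  by rewrite mulmx_sum_row -[RHS]k_eq0; apply: eq_bigr => j _; rewrite mxE.
by move/(canRL (mulmxK V_unit)); rewrite mul0mx => /rowP/(_ i); rewrite !mxE.
Qed.

(** The integer is the determinant of the matrix M of multiplication by p on
Z[X]/(f) in the basis of powers of 'X; M has integer entries because division
by a monic polynomial stays in Z[X].  Evaluation at the roots, that is, the
Vandermonde matrix, diagonalizes M with eigenvalues p(t_j). *)
Lemma prod_horner_roots_int {F : fieldType} {d : nat} {f : {poly int}}
    (p : {poly int}) {t : 'rV[F]_d} :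
  f \is monic -> size f = d.+1 -> injective (t 0) ->
  (forall j, root (map_poly intr f) (t 0 j)) ->
  exists z : int, \prod_(j < d) (map_poly intr p).[t 0 j] = z%:~R.
Proof.
move=> f_monic size_f t_inj f_root.
pose rem (i : 'I_d) := Pdiv.Ring.rmodp ('X^i * p) f.
pose M : 'M[int]_d := \matrix_(i, j) (rem i)`_j.
pose D : 'rV[F]_d := \row_j (map_poly intr p).[t 0 j].
have size_rem i : (size (rem i) <= d)%N.
  by rewrite -ltnS -size_f Pdiv.Ring.ltn_rmodp monic_neq0.
have MV : map_mx intr M *m Vandermonde d t = Vandermonde d t *m diag_mx D.
  apply/matrixP => i j; rewrite mul_mx_diag !mxE.
  transitivity (map_poly intr (rem i)).[t 0 j].
    rewrite (@horner_coef_wide _ d) ?(leq_trans (size_poly _ _)) //.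
    by apply: eq_bigr => k _; rewrite !mxE coef_map.
  have /(congr1 (fun q => (map_poly (intr : int -> F) q).[t 0 j])) :=
    Pdiv.RingMonic.rdivp_eq f_monic ('X^i * p).
  rewrite rmorphD !rmorphM /= map_polyXn !hornerE.
  by rewrite (rootP (f_root j)) mulr0 add0r => ->.
exists (\det M); have /(congr1 determinant) := MV.
rewrite !det_mulmx det_diag mulrC det_map_mx.
have := Vandermonde_unit t_inj; rewrite unitmxE unitfE => /mulfI detV_inj.
by move=> /detV_inj ->; apply: eq_bigr => j _; rewrite mxE.
Qed.

(** Irreducibility makes f and p coprime over Q, and a Bezout identity over Q
still holds in F, where it excludes a common root. *)
Lemma irreducible_horner_neq0 {F : numFieldType} {f p : {poly int}} {x : F} :
  irreducible_poly (map_poly (intr : int -> rat) f) ->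
  root (map_poly intr f) x -> p != 0 -> (size p < size f)%N ->
  (map_poly intr p).[x] != 0.
Proof.
move=> f_irr f_root p_neq0 lt_pf.
have ratrE (q : {poly int}) :
    map_poly intr q = map_poly ratr (map_poly (intr : int -> rat) q) :> {poly F}.
  by rewrite -map_poly_comp; apply: eq_map_poly => z /=; rewrite ratr_int.
move: f_root; rewrite !ratrE; apply: coprimep_root.
rewrite coprimep_map irreducible_poly_coprime // dvdp_rat_int.
by apply: contraL lt_pf => /(dvdp_leq p_neq0); rewrite -leqNgt.
Qed.

Theorem theorem2 (R : realType) (d : nat) (d_ge1 : (1 <= d)%N) :
  exists L : set 'rV[R]_d,
    full_rank_lattice L /\ L `&` hyperbolic_region R d = [set 0].
Proof.
have [t t_inj t_root] := exists_prodXsub_sub1_roots R d_ge1.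
pose V := Vandermonde d t; pose v := [tuple row i V | i < d].
exists (int_span v); split.
  by exists v => //; apply/basis_rows_unitmx/Vandermonde_unit.
apply/seteqP; split=> [x [] | _ ->]; last first.
  split; first by exists (fun=> 0); rewrite big1.
  rewrite /hyperbolic_region /= (bigD1 (Ordinal d_ge1)) //= mxE mul0r normr0.
  exact: ltr01.
move=> [a x_eq] x_hyp; apply/eqP; apply: contraTT x_hyp => x_neq0.
(* [insub] extends the coefficients [a], indexed by ['I_d], to all of [nat]. *)
pose p : {poly int} := \poly_(i < d) if insub i is Some i' then a i' else 0.
have xE j : x 0 j = (map_poly intr p).[t 0 j].
  rewrite (@horner_coef_wide _ d) ?(leq_trans (size_poly _ _)) ?size_poly //.
  rewrite x_eq summxE; apply: eq_bigr => i _.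
  by rewrite tnth_mktuple -scaler_int !mxE coef_map coef_poly ltn_ord valK.
have p_neq0 : p != 0.
  apply: contraNneq x_neq0 => p_eq0.
  by apply/eqP/rowP => j; rewrite xE p_eq0 rmorph0 horner0 mxE.
pose a4 (i : 'I_d) := (4 * i)%N%:Z.
have a4_inj : injective a4 by move=> i j [eq_4]; apply: val_inj => /=; lia.
have size_f := size_prodXsub_sub1 a4 d_ge1.
have [z z_eq] := prod_horner_roots_int p (monic_prodXsub_sub1 a4 d_ge1) size_f
  t_inj t_root.
have prod_neq0 : \prod_j (map_poly intr p).[t 0 j] != 0.
  apply/prodf_neq0 => j _.
  have f_irr := irreducible_prodXsub_sub1 a4 d_ge1 a4_inj.
  apply: (irreducible_horner_neq0 f_irr (t_root j)) => //.
  by rewrite size_f ltnS size_poly.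
rewrite /hyperbolic_region /=.
under eq_bigr do rewrite xE.
move: prod_neq0; rewrite z_eq intr_eq0 -leNgt -intr_norm ler1z => z_neq0.
by rewrite -gtz0_ge1 normr_gt0.
Qed.
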